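(* Let $k\ge2$, $0<\epsilon\le 1/2$, and let $f:\{0,1\}^m\to\{-1,1\}$ have $\delta$-approximate degree $d$. Let $n\ge\left(\frac{2^{2^k}(k-1)e}{d}\right)^{k-1}m^k$, and let $f':\{0,1\}^n\to\{-1,1\}$ satisfy $f(z)=f'(z0^{n-m})$ for all $z\in\{0,1\}^m$. Then \[R^\epsilon_k(G^{f'}_k)\ge\frac{d}{2^{k-1}}+\log_2(\delta+2\epsilon-1).\]
   Context: For $S\subseteq[m]$, $\chi_S(x)=(-1)^{\sum_{i\in S}x_i}$; every $\phi:\{0,1\}^m\to\mathbb{R}$ has a unique expansion $\sum_S\hat\phi(S)\chi_S$, and its exact degree is the largest $|S|$ with $\hat\phi(S)\ne0$. The $\delta$-approximate degree of $f$ is the smallest $d$ such that some $\phi:\{0,1\}^m\to\mathbb{R}$ of exact degree $d$ satisfies $\max_x|f(x)-\phi(x)|\le\delta$. For $x,y^1,\ldots,y^{k-1}\in\{0,1\}^n$, let $i_1<\cdots<i_t$ be the indices $j$ with $y^1_j=\cdots=y^{k-1}_j=1$, and $x\Leftarrow y^1,\ldots,y^{k-1}:=x_{i_1}\cdots x_{i_t}0^{n-t}$. For $g:\{0,1\}^n\to\{-1,1\}$, $G^g_k(x,y^1,\ldots,y^{k-1})=g(x\Leftarrow y^1,\ldots,y^{k-1})$. NOF model: $k$ players, player $1$ sees all inputs except $x$, player $i+1$ sees all inputs except $y^i$; they communicate by writing bits on a shared blackboard. $R^\epsilon_k(h)$ is the minimum worst-case communication of a public-coin randomized protocol that on every input outputs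 $h$ with probability at least $1/2+\epsilon$. *)

(* Defs.v *)
From HB Require Import structures.
From mathcomp Require Import all_boot all_order all_algebra.
From mathcomp Require Import all_classical all_reals all_analysis.

Set Implicit Arguments.
Unset Strict Implicit.
Unset Printing Implicit Defensive.

Import Order.TTheory GRing.Theory Num.Theory.

Local Open Scope ring_scope.

Definition cube (n : nat) := {ffun 'I_n -> bool}.

(* {-1,1}-valued functions are represented by bool-valued ones; [pm1] is the
   bijection from bool onto {-1,1}. *)
Definition pm1 (R : realType) (b : bool) : R := (-1) ^+ b.

Definition log2 (R : realType) (x : R) : R := ln x / ln 2.

Definition is_least (A : nat -> Prop) (d : nat) : Prop :=
  A d /\ forall d', A d' -> (d <= d')%N.

Section ApproximateDegree.
Variables (R : realType) (m : nat).
Implicit Types (S T : {set 'I_m}) (phi : cube m -> R).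

Definition chi S (x : cube m) : R := (-1) ^+ (\sum_(i in S) x i)%N.

Definition fourier phi S : R := (2 ^+ m)^-1 * \sum_(x : cube m) phi x * chi S x.

Let chiE S x : chi S x = \prod_i (if i \in S then pm1 R (x i) else 1).
Proof.
rewrite /chi -big_mkcond /=; elim/big_rec2: _ => [|i a b _ <-] //.
by rewrite exprD.
Qed.

Lemma fourier_expansion phi x : phi x = \sum_S fourier phi S * chi S x.
Proof.
have ortho (y : cube m) :
    \sum_S chi S y * chi S x = (if y == x then 2 ^+ m else 0) :> R.
  transitivity (\prod_i (pm1 R (y i) * pm1 R (x i) + 1)).
    rewrite bigA_distr; apply: eq_bigr => S _.
    rewrite !chiE -big_split /=; apply: eq_bigr => i _.
    by case: ifP; rewrite ?mulr1.
  case: eqP => [->|/eqP yx].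
    rewrite (eq_bigr (fun=> 2)) ?prodr_const ?card_ord// => i _.
    by rewrite /pm1 -expr2 sqrr_sign.
  have [i yxi] : exists i, y i != x i.
    apply/existsP; apply: contraR yx; rewrite negb_exists => /forallP yx.
    by apply/eqP/ffunP => i; have := yx i; rewrite negbK => /eqP.
  rewrite (bigD1 i) //= /pm1; move: yxi.
  by case: (y i) (x i) => -[] //= _; rewrite ?(mulr1, mul1r) addNr mul0r.
under eq_bigr do rewrite /fourier -mulrA mulr_suml mulr_sumr.
rewrite exchange_big (bigD1 x) //= [X in _ + X]big1 => [|y /negPf yx].
  rewrite addr0; under eq_bigr do rewrite -mulrA.
  by rewrite -mulr_sumr -mulr_sumr ortho eqxx mulrCA mulVf ?mulr1//.
under eq_bigr do rewrite -mulrA.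
by rewrite -mulr_sumr -mulr_sumr ortho yx !mulr0.
Qed.

Lemma fourier_unique phi (c : {set 'I_m} -> R) :
  (forall x, phi x = \sum_S c S * chi S x) -> forall S, c S = fourier phi S.
Proof.
move=> phiE S.
have ortho T :
    \sum_(x : cube m) chi T x * chi S x = (if T == S then 2 ^+ m else 0) :> R.
  transitivity (\prod_i \sum_b
      (if i \in T then pm1 R b else 1) * (if i \in S then pm1 R b else 1)).
    rewrite bigA_distr_bigA; apply: eq_bigr => x _.
    by rewrite !chiE -big_split.
  case: eqP => [->|/eqP TS].
    rewrite (eq_bigr (fun=> 2)) ?prodr_const ?card_ord// => i _.
    by rewrite big_bool /pm1; case: ifP => _; rewrite ?mulr1 ?mulrNN ?mulr1.
  have [i TSi] : exists i, (i \in T) != (i \in S).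
    apply/existsP; apply: contraR TS; rewrite negb_exists => /forallP TS.
    by apply/eqP/setP => i; have := TS i; rewrite negbK => /eqP.
  rewrite (bigD1 i) //= big_bool /pm1; move: TSi.
  by case: (i \in T) (i \in S) => -[] //= _;
    rewrite ?(mulr1, mul1r) addNr mul0r.
rewrite /fourier; under eq_bigr do rewrite phiE mulr_suml.
rewrite exchange_big (bigD1 S) //= [X in _ + X]big1 => [|T /negPf TS].
  rewrite addr0; under eq_bigr do rewrite -mulrA.
  by rewrite -mulr_sumr ortho eqxx mulrCA mulVf ?mulr1.
under eq_bigr do rewrite -mulrA.
by rewrite -mulr_sumr ortho TS mulr0.
Qed.

(* The zero function gets degree 0. *)
Definition exact_degree phi : nat := \max_(S | fourier phi S != 0) #|S|.

Definition is_approx_degree (delta : R) (f : cube m -> R) (d : nat) : Prop :=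
  is_least (fun d' => exists phi,
    exact_degree phi = d' /\ forall x, `|f x - phi x| <= delta) d.

End ApproximateDegree.

Definition zero_pad (m n : nat) (z : cube m) : cube n :=
  [ffun j : 'I_n => nth false [seq z i | i <- enum 'I_m] j].

(* x <= (y i)_i : the default value of [nth] provides the trailing zeros. *)
Definition select (n : nat) (I : finType) (x : cube n) (y : I -> cube n) :
    cube n :=
  [ffun j : 'I_n =>
     nth false [seq x l | l <- enum 'I_n & [forall i, y i l]] j].

(* The k players are indexed by [option 'I_k.-1] (which has k elements for
   k >= 1): [u None] is x, on the forehead of player 1, and [u (Some i)], for i
   ranging from 0 to k - 2, is y^{i+1}, on the forehead of player i + 2. *)
Definition G (k n : nat) (g : cube n -> bool)
    (u : {ffun option 'I_k.-1 -> cube n}) : bool :=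
  g (select (u None) (fun i => u (Some i))).

Section NumberOnForehead.
Variables (I : finType) (X T : Type).
Implicit Types (u : {ffun I -> X}).

Definition visible (i : I) u : {ffun {j : I | j != i} -> X} :=
  [ffun j => u (val j)].

(* A node is a state of the blackboard: the speaker i writes the bit [msg v],
   where v is what i sees, and the protocol goes on with the second subtree if
   that bit is 1 and with the first one otherwise. *)
Inductive protocol : Type :=
| Output of T
| Speak (i : I) (msg : {ffun {j : I | j != i} -> X} -> bool)
    of protocol & protocol.

Fixpoint output (p : protocol) u : T :=
  match p with
  | Output t => t
  | Speak i msg p0 p1 => output (if msg (visible i u) then p1 else p0) u
  end.

Fixpoint bits_written (p : protocol) u : nat :=
  match p with
  | Output _ => 0
  | Speak i msg p0 p1 =>
      (bits_written (if msg (visible i u) then p1 else p0) u).+1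
  end.

(* The public coins are drawn from an arbitrary probability space; given the
   coins, the protocol is deterministic. *)
Definition randomized_cost_le (R : realType) (eps : R)
    (h : {ffun I -> X} -> T) (c : nat) : Prop :=
  exists (disp : measure_display) (W : measurableType disp)
         (P : probability W R) (pi : W -> protocol),
    (forall w u, (bits_written (pi w) u <= c)%N) /\
    (forall u, measurable [set w | output (pi w) u = h u]%classic /\
       ((1 / 2 + eps)%:E <= P [set w | output (pi w) u = h u]%classic)%E).

(* A minimum over naturals, taken in the extended reals: it is +oo if no
   protocol is correct with probability at least 1/2 + eps. *)
Definition randomized_complexity (R : realType) (eps : R)
    (h : {ffun I -> X} -> T) : \bar R :=
  ereal_inf [set c%:R%:E | c in randomized_cost_le eps h]%classic.

End NumberOnForehead.

(* Main.v *)
(* By linear programming duality, approximate degree [d] yields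
   [psi : cube m -> R] of l1-norm at most 1, orthogonal to all polynomials of
   degree less than [d], with correlation at least [delta] with [f].  Cut (part
   of) [x] into [m] blocks, each a cube of side [l] with one dimension per y^i,
   and let each y^i choose one coordinate in every block: the selected bits form
   a pattern [z] of length [m], and [G f'] evaluates to [f z].  The signed measure
   with density proportional to [psi z] correlates with [f z] as [psi] with [f].

   Its correlation with a cylinder intersection is bounded by Cauchy-Schwarz,
   one player at a time, by the average over two copies s0, s1 of the choices of
   |E_x \prod_v psi(z_v)|, where v ranges over the ways to mix s0 and s1.  Let q
   be the number of blocks in which some coordinate of s0 and s1 collides.  The
   inner expectation vanishes if q < d and is at most
   2^((2^(k-1) - 1) q) 2^(- m 2^(k-1)) in general.  As collisions have
   probability at most (k-1)/l per block, an exponential moment of q gives the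
   bound 2^-d for the 2^(k-1)-th power of the correlation.  A protocol that
   writes [c] bits splits into 2^c cylinder intersections, and averaging over the
   coins of a randomized protocol of advantage [eps] produces a deterministic one
   with correlation at least [delta + 2 eps - 1]. *)

Require Import Defs.
From mathcomp Require Import all_boot all_order all_algebra.
From mathcomp Require Import all_classical all_reals all_analysis.
From mathcomp Require Import ring lra.

Set Implicit Arguments.
Unset Strict Implicit.
Unset Printing Implicit Defensive.

Import Order.TTheory GRing.Theory Num.Theory.
Local Open Scope ring_scope.

(** * Linear programming duality *)

(** This supplies the value of the eliminated unknown in Fourier-Motzkin elimination: the largest
    lower bound, or the smallest upper bound if there is no lower one. *)
Lemma finite_separation (R : realFieldType) (I : finType) (P Q : pred I)
    (F : I -> R) :
  (forall u v, P u -> Q v -> F v <= F u) ->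
  exists c, (forall u, P u -> c <= F u) /\ (forall v, Q v -> F v <= c).
Proof.
move=> QP; case: (pickP Q) => [v0 Qv0|Q0].
  exists (F [arg max_(v > v0 | Q v) F v]%O).
  case: arg_maxP => // v Qv vmax; split=> [u Pu|w Qw]; first exact: QP.
  exact: vmax.
case: (pickP P) => [u0 Pu0|P0].
  exists (F [arg min_(u < u0 | P u) F u]%O).
  case: arg_minP => // u Pu umin; split=> [w Pw|w]; last by rewrite Q0.
  exact: umin.
by exists 0; split=> u; rewrite ?P0 ?Q0.
Qed.

(* Farkas' lemma, by Fourier-Motzkin elimination: [M] lists the nonnegative
   combinations of constraints that do not involve the first unknown. *)
Lemma farkas (R : realFieldType) (n : nat) (I : finType)
    (A : I -> 'I_n -> R) (b : I -> R) :
  (forall c : 'I_n -> R, exists i, b i < \sum_j A i j * c j) ->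
  exists y : I -> R, [/\ forall i, 0 <= y i,
    forall j, \sum_i y i * A i j = 0 & \sum_i y i * b i < 0].
Proof.
elim: n I A b => [|n IHn] I A b infeasible.
  have [i] := infeasible (fun=> 0); rewrite big_ord0 => bi.
  exists (fun k => (k == i)%:R); split=> [k|[]//|]; first exact: ler0n.
  rewrite (bigD1 i) //= eqxx mul1r big1 ?addr0// => k /negPf ->.
  by rewrite mul0r.
pose p k := A k ord0.
(* The weights [- p v] and [p u] cancel the first coefficients of rows [u] and [v]. An index of the
   wrong sign pattern yields the zero row. *)
pose M (i' : I + I * I) (k : I) : R := match i' with
  | inl i => ((p i == 0) && (k == i))%:R
  | inr (u, v) => if (0 < p u) && (p v < 0)
                  then (k == u)%:R * - p v + (k == v)%:R * p u else 0
  end.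
have M_ge0 i' k : 0 <= M i' k.
  case: i' => [i|[u v]] /=; first exact: ler0n.
  case: ifP => // /andP[pu pv].
  by rewrite addr_ge0 ?mulr_ge0 ?ler0n ?oppr_ge0 ?(ltW pv) ?(ltW pu).
have sum_delta i (F : I -> R) : \sum_k (k == i)%:R * F k = F i.
  rewrite (bigD1 i) //= eqxx mul1r big1 ?addr0// => k /negPf ->.
  by rewrite mul0r.
have sum_inl i (F : I -> R) : p i = 0 -> \sum_k M (inl i) k * F k = F i.
  by move=> pi; rewrite /M /= pi eqxx /= sum_delta.
have sum_inr u v (F : I -> R) : 0 < p u -> p v < 0 ->
    \sum_k M (inr (u, v)) k * F k = - p v * F u + p u * F v.
  move=> pu pv; rewrite /M /= pu pv /=.
  under eq_bigr do rewrite mulrDl -!mulrA.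
  by rewrite big_split /= !sum_delta.
have Mp i' : \sum_k M i' k * p k = 0.
  case: i' => [i|[u v]].
    have [pi|pi] := eqVneq (p i) 0; first by rewrite sum_inl.
    by rewrite big1 // => k _; rewrite /M (negPf pi) mul0r.
  case: (boolP ((0 < p u) && (p v < 0))) => [/andP[pu pv]|/negPf uv].
    by rewrite sum_inr // mulNr mulrC addNr.
  by rewrite big1 // => k _; rewrite /M uv mul0r.
pose A' i' j := \sum_k M i' k * A k (lift ord0 j).
pose b' i' := \sum_k M i' k * b k.
have [c'|y [y_ge0 yA yb]] := IHn _ A' b'.
  apply/existsP; apply: contraT; rewrite negb_exists => /forallP feasible.
  (* With the other unknowns fixed at [c'], constraint [k] reads [p k * c0 <= e k]. It bounds [c0]
     by [e k / p k], from above if [p k > 0] and from below if [p k < 0]; the combined row of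
     [(u, v)] says that these two bounds are compatible. *)
  pose e k := b k - \sum_j A k (lift ord0 j) * c' j.
  have Me i' : 0 <= \sum_k M i' k * e k.
    have := feasible i'; rewrite -leNgt -subr_ge0 => /le_trans; apply.
    rewrite le_eqVlt; apply/orP; left; apply/eqP.
    rewrite /b' /A'.
    under [X in _ - X]eq_bigr do rewrite mulr_suml.
    rewrite exchange_big /= -sumrB; apply: eq_bigr => k _.
    rewrite /e mulrBr mulr_sumr; congr (_ - _); apply: eq_bigr => j _.
    by rewrite mulrA.
  have [u v pu pv|c0 [c0_le c0_ge]] := @finite_separation R I
      (fun k => 0 < p k) (fun k => p k < 0) (fun k => e k / p k).
    have := Me (inr (u, v)); rewrite sum_inr //.
    rewrite ler_pdivlMr // mulrAC ler_ndivrMr //.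
    by lra.
  have [i] := infeasible
    (fun j => if unlift ord0 j is Some j' then c' j' else c0).
  rewrite big_ord_recl unlift_none; under eq_bigr do rewrite liftK.
  rewrite -ltrBlDr -/(e i) -/(p i) => ei.
  suff : p i * c0 <= e i by rewrite leNgt ei.
  case: (ltgtP (p i) 0) => [pi|pi|pi].
  - by rewrite mulrC -ler_ndivrMr // c0_ge.
  - by rewrite mulrC -ler_pdivlMr // c0_le.
  - by rewrite pi mul0r -(sum_inl i e pi).
exists (fun k => \sum_i' y i' * M i' k); split.
- by move=> k; apply: sumr_ge0 => i' _; rewrite mulr_ge0.
- move=> j; under eq_bigr do rewrite mulr_suml.
  rewrite exchange_big /=; under eq_bigr do under eq_bigr do rewrite -mulrA.
  under eq_bigr do rewrite -mulr_sumr.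
  case: (unliftP ord0 j) => [j' ->|->]; first exact: yA.
  by rewrite big1 // => i' _; rewrite Mp mulr0.
- under eq_bigr do rewrite mulr_suml.
  rewrite exchange_big /=; under eq_bigr do under eq_bigr do rewrite -mulrA.
  by under eq_bigr do rewrite -mulr_sumr.
Qed.

Lemma exact_degree_lt (R : realType) (m d : nat) (phi : cube m -> R) :
  (0 < d)%N -> (forall S : {set 'I_m}, (d <= #|S|)%N -> fourier phi S = 0) ->
  (exact_degree phi < d)%N.
Proof.
move=> d_gt0 phi0; rewrite -(prednK d_gt0) ltnS; apply/bigmax_leqP => S.
apply: contraNT; rewrite -ltnNge prednK // => dS.
by rewrite phi0.
Qed.

Lemma approx_degree_le (R : realType) (m d : nat) (delta : R)
    (f : cube m -> R) : is_approx_degree delta f d -> (d <= m)%N.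
Proof.
case=> -[phi [<- _]] _; apply/bigmax_leqP => S _.
by rewrite -[leqRHS]card_ord max_card.
Qed.

(* [psi] is the normalized difference of the Farkas multipliers of the
   constraints [phi z >= f z - delta] and [phi z <= f z + delta] in the unknown
   low-degree coefficients of [phi]. *)
Lemma dual_polynomial (R : realType) (m d : nat) (delta : R)
    (f : cube m -> R) :
  (0 < d)%N -> is_approx_degree delta f d ->
  exists psi : cube m -> R, [/\ \sum_z `|psi z| <= 1,
    delta <= \sum_z psi z * f z &
    forall S : {set 'I_m}, (#|S| < d)%N -> fourier psi S = 0].
Proof.
move=> d_gt0 [[phi0 [_ phi0f]] dmin].
have delta_ge0 : 0 <= delta.
  exact: le_trans (normr_ge0 _) (phi0f [ffun=> false]).
pose low : {pred {set 'I_m}} := [pred S : {set 'I_m} | (#|S| < d)%N].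
have low0 : finset.set0 \in low by rewrite inE cards0.
pose sgn (i : cube m + cube m) : R := if i is inl _ then 1 else -1.
pose pt (i : cube m + cube m) : cube m := match i with inl z | inr z => z end.
pose A i (j : 'I_#|low|) := sgn i * chi R (enum_val j) (pt i).
pose b i := delta + sgn i * f (pt i).
have [c|y [y_ge0 yA yb]] := @farkas R _ _ A b.
  pose co S := if S \in low then c (enum_rank_in low0 S) else 0.
  pose phi z := \sum_S co S * chi R S z.
  have phiE z : phi z = \sum_j c j * chi R (enum_val j) z.
    rewrite (big_enum_rank low0) /phi [RHS]big_mkcond; apply: eq_bigr => S _.
    rewrite /co; case: ifP => [Sl|]; last by rewrite mul0r.
    by rewrite enum_rankK_in.
  have deg_phi : (exact_degree phi < d)%N.
    apply: exact_degree_lt => // S dS.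
    by rewrite -(@fourier_unique _ _ phi co) // /co inE ltnNge dS /=.
  (* If [c] met all constraints, [phi] would approximate [f] within [delta] with degree below [d],
     against the minimality of [d]. *)
  apply: contrapT => infeasible.
  have feasible i : \sum_j A i j * c j <= b i.
    by rewrite leNgt; apply/negP => bi; exact: infeasible (ex_intro _ i bi).
  suff : (d <= exact_degree phi)%N by rewrite leqNgt deg_phi.
  apply: dmin; exists phi; split=> // z.
  have SE i : \sum_j A i j * c j = sgn i * phi (pt i).
      rewrite phiE mulr_sumr; apply: eq_bigr => j _.
      by rewrite /A -mulrA; congr (_ * _); rewrite mulrC.
    have := feasible (inl z); have := feasible (inr z).
    rewrite !SE /b /sgn /pt; rewrite ler_norml; lra.
have sumE (F : cube m + cube m -> R) :
    \sum_i F i = \sum_z F (inl z) + \sum_z F (inr z) by rewrite big_sumType.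
pose Y := \sum_i y i.
have Y_ge0 : 0 <= Y by apply: sumr_ge0.
have Y_gt0 : 0 < Y.
  rewrite lt_def Y_ge0 andbT; apply/negP => /eqP /psumr_eq0P Y0.
  by move: yb; rewrite big1 ?ltxx // => i _; rewrite Y0 ?mul0r.
pose psi z := (y (inr z) - y (inl z)) / Y.
have psiE (F : cube m -> R) :
    \sum_z psi z * F z = - (\sum_i y i * (sgn i * F (pt i))) / Y.
  rewrite sumE /psi -big_split /= mulNr -mulrN mulr_suml.
  by apply: eq_bigr => z _; rewrite mulrN; field; apply: lt0r_neq0.
exists psi; split.
- rewrite -(ler_pM2r Y_gt0) mul1r mulr_suml [leRHS]sumE -big_split /=.
  apply: ler_sum => z _.
  rewrite /psi normrM normfV (gtr0_norm Y_gt0) divfK ?lt0r_neq0 //.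
  by rewrite (le_trans (ler_normB _ _)) // !ger0_norm // addrC lexx.
- rewrite (psiE f) ler_pdivlMr // -subr_ge0 -oppr_le0 opprB opprK addrC.
  rewrite /Y mulr_sumr -big_split /= ltW //.
  rewrite (eq_bigr (fun i => y i * b i)) // => i _.
  by rewrite /b mulrDr addrC (mulrC delta).
- move=> S Sd; rewrite /fourier (psiE (chi R S)).
  have -> : \sum_i y i * (sgn i * chi R S (pt i)) = 0.
    rewrite -[RHS](yA (enum_rank_in low0 S)).
    by apply: eq_bigr => i _; rewrite /A enum_rankK_in.
  by rewrite oppr0 mul0r mulr0.
Qed.

(** * Cylinder intersections *)

Definition avg (R : realType) (T : finType) (f : T -> R) : R :=
  (\sum_t f t) / #|T|%:R.

Lemma eq_avg (R : realType) (T : finType) (f g : T -> R) :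
  f =1 g -> avg f = avg g.
Proof. by move=> fg; rewrite /avg; congr (_ / _); apply: eq_bigr. Qed.

Lemma avgZ (R : realType) (T : finType) (c : R) (f : T -> R) :
  avg (fun t => c * f t) = c * avg f.
Proof. by rewrite /avg -mulr_sumr mulrA. Qed.

Lemma avg_cst (R : realType) (T : finType) (c : R) :
  (0 < #|T|)%N -> avg (fun _ : T => c) = c.
Proof.
move=> T0; rewrite /avg sumr_const -[c *+ _]mulr_natr mulfK //.
by rewrite pnatr_eq0 -lt0n.
Qed.

Lemma ler_avg (R : realType) (T : finType) (f g : T -> R) :
  (forall t, f t <= g t) -> avg f <= avg g.
Proof.
by move=> fg; rewrite /avg ler_wpM2r ?invr_ge0 ?ler0n // ler_sum.
Qed.

Lemma ler_norm_avg (R : realType) (T : finType) (f : T -> R) :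
  `|avg f| <= avg (fun t => `|f t|).
Proof.
rewrite /avg normrM [X in _ * X]ger0_norm ?invr_ge0 ?ler0n //.
by rewrite ler_wpM2r ?invr_ge0 ?ler0n // ler_norm_sum.
Qed.

(** The gap between the two sides is the variance of [f], an average of squares. This is the form in
    which Cauchy-Schwarz is used below. *)
Lemma sqr_avg_le (R : realType) (T : finType) (f : T -> R) :
  avg f ^+ 2 <= avg (fun t => f t ^+ 2).
Proof.
have [T0|T0] := posnP #|T|; first by rewrite /avg T0 invr0 !mulr0 expr0n.
have N0 : #|T|%:R != 0 :> R by rewrite pnatr_eq0 -lt0n.
have : 0 <= avg (fun t => (f t - avg f) ^+ 2).
  by rewrite mulr_ge0 ?invr_ge0 ?ler0n // sumr_ge0 // => t _; rewrite sqr_ge0.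
suff -> : avg (fun t => (f t - avg f) ^+ 2) =
    avg (fun t => f t ^+ 2) - avg f ^+ 2 by rewrite subr_ge0.
set mu := avg f.
have sumf : \sum_t f t = mu * #|T|%:R by rewrite /mu /avg divfK.
rewrite /avg; under eq_bigr do rewrite sqrrB -mulrnAr.
rewrite big_split sumrB /= -mulr_suml sumf sumr_const -[mu ^+ 2 *+ _]mulr_natr.
by rewrite -[mu *+ 2]mulr_natr; field.
Qed.

Lemma exchange_avg (R : realType) (T U : finType) (f : T -> U -> R) :
  avg (fun t => avg (f t)) = avg (fun u => avg (fun t => f t u)).
Proof.
rewrite /avg -!mulr_suml exchange_big /= -!mulrA; congr (_ * _).
by rewrite mulrC.
Qed.

Section Mixing.
Variables (R : realType) (S J : finType).
Implicit Types (s : {ffun J -> S}) (v A : {set J}).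

Definition update s (i : J) (a : S) : {ffun J -> S} :=
  [ffun j => if j == i then a else s j].

Definition mix s0 s1 v : {ffun J -> S} :=
  [ffun j => if j \in v then s1 j else s0 j].

(** Exchanging [a] with the [i]-th coordinate of [s] is an involution on pairs. Hence one coordinate
    may be resampled independently of the others. *)
Lemma avg_update (F : {ffun J -> S} -> R) (i : J) : (0 < #|S|)%N ->
  avg (fun s => avg (fun a => F (update s i a))) = avg F.
Proof.
move=> S0; have SR : #|S|%:R != 0 :> R by rewrite pnatr_eq0 -lt0n.
rewrite /avg -mulr_suml; congr (_ / _); apply: (mulIf SR); rewrite divfK //.
rewrite pair_big /=.
pose h (p : {ffun J -> S} * S) := (update p.1 i p.2, p.1 i).
have hK : cancel h h.
  move=> [s a]; rewrite /h /= ffunE eqxx; congr (_, _).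
  by apply/ffunP => j; rewrite !ffunE; case: eqP => // ->.
rewrite (reindex h); last by exists h => p _; rewrite hK.
rewrite (eq_bigr (fun p => F p.1)) => [|[s a] _].
  rewrite -(pair_big xpredT xpredT (fun s (_ : S) => F s)) /=.
  rewrite mulr_suml; apply: eq_bigr => s _.
  by rewrite sumr_const mulr_natr.
by congr F; have [] := hK (s, a).
Qed.

Lemma prod_subsetU1 (i : J) A (F : {set J} -> R) : i \notin A ->
  \prod_(v : {set J} | v \subset i |: A) F v =
  \prod_(v : {set J} | v \subset A) (F v * F (i |: v)).
Proof.
move=> iA; rewrite (bigID (fun v : {set J} => i \in v)) /= mulrC big_split /=.
congr (_ * _).
  by apply: eq_bigl => v; rewrite -subsetD1 finset.setU1K.
rewrite (reindex_onto (fun v => i |: v) (fun v => v :\ i)) /=; last first.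
  by move=> v /andP[_ iv]; rewrite finset.setD1K.
apply: eq_bigl => v; rewrite finset.setU11 andbT.
apply/andP/idP => [[vA /eqP iv]|vA].
  by have := finset.setSD [set i]%SET vA; rewrite iv finset.setU1K.
rewrite finset.setUS //; split=> //; rewrite finset.setU1K //.
by apply: contra iA; apply/fintype.subsetP.
Qed.

End Mixing.

(* The Cauchy-Schwarz inequality is applied once for each player [j] to get rid
   of the factor [phi j], which does not depend on the [j]-th coordinate. *)
Lemma cylinder_correlation (R : realType) (X S J : finType)
    (w : X -> {ffun J -> S} -> R) (phi0 : {ffun J -> S} -> R)
    (phi : J -> X -> {ffun J -> S} -> R) :
  (0 < #|S|)%N ->
  (forall s, `|phi0 s| <= 1) -> (forall j x s, `|phi j x s| <= 1) ->
  (forall j x s a, phi j x (update s j a) = phi j x s) ->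
  `|avg (fun x => avg (fun s => w x s * (phi0 s * \prod_j phi j x s)))|
    ^+ (2 ^ #|J|) <=
  avg (fun s0 => avg (fun s1 => `|avg (fun x => \prod_v w x (mix s0 s1 v))|)).
Proof.
move=> S0 phi0_le phi_le phi_update.
have V0 : (0 < #|{ffun J -> S}|)%N by rewrite card_ffun expn_gt0 S0.
(* [A] is the set of players already eliminated: [g A] lacks their factors, and [Q A] takes their
   coordinates from both copies in all combinations. *)
pose g (A : {set J}) x s := w x s * (phi0 s * \prod_(j | j \notin A) phi j x s).
pose Q (A : {set J}) := avg (fun x => avg (fun s0 => avg (fun s1 =>
  \prod_(v : {set J} | v \subset A) g A x (mix s0 s1 v)))).
have Qstep i (A : {set J}) : i \notin A -> Q A ^+ 2 <= Q (i |: A).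
  move=> iA; apply: le_trans (sqr_avg_le _) _; apply: ler_avg => x.
  (* [P] collects the factors to be removed, which ignore coordinate [i] of [s0]; [B] collects the
     rest. *)
  pose B s0 s1 := \prod_(v : {set J} | v \subset A) g (i |: A) x (mix s0 s1 v).
  pose P s0 s1 := \prod_(v : {set J} | v \subset A) phi i x (mix s0 s1 v).
  have split_g s0 s1 : \prod_(v : {set J} | v \subset A) g A x (mix s0 s1 v) =
      P s0 s1 * B s0 s1.
    rewrite -big_split; apply: eq_bigr => v _.
    rewrite /g (bigD1 i) //= (eq_bigl (fun j => j \notin i |: A)); last first.
      by move=> j; rewrite !inE negb_or andbC.
    by ring.
  have iv (v : {set J}) : v \subset A -> i \notin v.
    by move=> vA; apply: contra iA; exact: (fintype.subsetP vA).
  have P_update s0 s1 a : P (update s0 i a) s1 = P s0 s1.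
    apply: eq_bigr => v /iv vi.
    have -> : mix (update s0 i a) s1 v = update (mix s0 s1 v) i a.
      apply/ffunP => j; rewrite !ffunE; case: (eqVneq j i) => [->|//].
      by rewrite (negPf vi).
    exact: phi_update.
  have B_update s0 s1 a : B s0 (update s1 i a) = B s0 s1.
    apply: eq_bigr => v /iv vi; congr (g _ _ _); apply/ffunP => j.
    by rewrite !ffunE; case: (eqVneq j i) => [->|//]; rewrite (negPf vi).
  have P_le s0 s1 : `|P s0 s1| <= 1.
    rewrite normr_prod; apply: Num.Theory.prodr_ile1 => v _.
    by rewrite normr_ge0 phi_le.
  (* Coordinate [i] is resampled as [a] in [s0] and as [b] in [s1]. Subsets without [i] read [a] and
     those with [i] read [b], so the average over [a] and [b] is the square of a single average. *)
  have -> : avg (fun s0 => avg (fun s1 =>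
      \prod_(v : {set J} | v \subset i |: A) g (i |: A) x (mix s0 s1 v))) =
    avg (fun s1 => avg (fun s0 => avg (fun a => avg (fun b =>
      B (update s0 i a) s1 * B (update s0 i b) s1)))).
    rewrite exchange_avg -(avg_update _ i S0); apply: eq_avg => s1.
    transitivity (avg (fun b => avg (fun s0 => avg (fun a =>
        B (update s0 i a) s1 * B (update s0 i b) s1)))).
      apply: eq_avg => b; rewrite -(avg_update _ i S0); apply: eq_avg => s0.
      apply: eq_avg => a; rewrite prod_subsetU1 // big_split /=; congr (_ * _).
        exact: B_update.
      rewrite -[RHS](B_update _ _ b); apply: eq_bigr => v /iv vi.
      congr (g _ _ _); apply/ffunP => j; rewrite !ffunE !inE.
      by case: (eqVneq j i) => [->|//] /=; rewrite (negPf vi).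
    by rewrite exchange_avg; apply: eq_avg => s0; rewrite exchange_avg.
  rewrite exchange_avg; apply: le_trans (sqr_avg_le _) _.
  apply: ler_avg => s1.
  rewrite -(avg_update _ i S0).
  rewrite (eq_avg (g := fun s0 =>
      P s0 s1 * avg (fun a => B (update s0 i a) s1))); last first.
    by move=> s0; rewrite -avgZ; apply: eq_avg => a; rewrite split_g P_update.
  apply: le_trans (sqr_avg_le _) _; apply: ler_avg => s0.
  rewrite exprMn.
  apply: (@le_trans _ _ (avg (fun a => B (update s0 i a) s1) ^+ 2)).
    rewrite ler_piMl ?sqr_ge0 // -real_normK ?num_real //.
    by rewrite exprn_ile1 // normr_ge0.
  rewrite expr2 -avgZ le_eqVlt; apply/orP; left; apply/eqP.
  rewrite exchange_avg; apply: eq_avg => a; rewrite mulrC -avgZ.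
  by apply: eq_avg => b; rewrite mulrC.
have Qpow (A : {set J}) : `|Q finset.set0| ^+ (2 ^ #|A|) <= `|Q A|.
  move cA: #|A| => n; elim: n A cA => [|n IH] A cA.
    by rewrite (cards0_eq cA) expr1.
  have /card_gt0P[i iA] : (0 < #|A|)%N by rewrite cA.
  have iA' : i \notin A :\ i by rewrite !inE eqxx.
  have {}cA : #|A :\ i| = n by move: cA; rewrite (cardsD1 i) iA => -[].
  rewrite -(finset.setD1K iA) expnS mulnC exprM.
  apply: le_trans (_ : `|Q (A :\ i)| ^+ 2 <= _).
    by rewrite lerXn2r ?IH // nnegrE ?exprn_ge0 ?normr_ge0.
  rewrite real_normK ?num_real //.
  exact: le_trans (Qstep i _ iA') (ler_norm _).
have := Qpow [set: J]; rewrite cardsT.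
have -> : Q finset.set0 =
    avg (fun x => avg (fun s => w x s * (phi0 s * \prod_j phi j x s))).
  apply: eq_avg => x; apply: eq_avg => s.
  rewrite -[RHS](avg_cst _ V0); apply: eq_avg => s1.
  rewrite (big_pred1 finset.set0) => [|v]; last by rewrite finset.subset0.
  have -> : mix s s1 finset.set0 = s by apply/ffunP => j; rewrite ffunE inE.
  by rewrite /g; congr (_ * (_ * _)); apply: eq_bigl => j; rewrite inE.
move=> /le_trans; apply; rewrite /Q exchange_avg.
apply: le_trans (ler_norm_avg _) _; apply: ler_avg => s0.
rewrite exchange_avg; apply: le_trans (ler_norm_avg _) _; apply: ler_avg => s1.
(* Once all players are eliminated only [phi0] is left. It does not depend on [x], so it leaves the
   inner average and is bounded by 1. *)
rewrite (eq_avg (g := fun x => \prod_v phi0 (mix s0 s1 v) *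
    \prod_v w x (mix s0 s1 v))) => [|x].
  rewrite avgZ normrM ler_piMl ?normr_ge0 // normr_prod.
  by apply: Num.Theory.prodr_ile1 => v _; rewrite normr_ge0 phi0_le.
rewrite -big_split; apply: eq_big => v; first by rewrite finset.subsetT.
move=> _; rewrite /g mulrC big1 ?mulr1 // => j; by rewrite inE.
Qed.

(** * Patterns *)

Lemma card_agree (n : nat) (D : {set 'I_n}) (g : cube n) :
  (#|[set x : cube n | [forall l in D, x l == g l]]| * 2 ^ #|D| = 2 ^ n)%N.
Proof.
rewrite cardsE.
pose F (l : 'I_n) := [pred b : bool | (l \in D) ==> (b == g l)].
have -> : #|[pred x : cube n | [forall l in D, x l == g l]]| = #|family F|.
  by apply: eq_card => x; rewrite !inE.
rewrite card_family foldrE big_image /=.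
rewrite (eq_bigr (fun l => if l \in ~: D then 2 else 1)%N) => [|l _].
  by rewrite -big_mkcond prod_nat_const -expnD addnC cardsC card_ord.
rewrite inE; case lD: (l \in D) => /=.
  by rewrite -(card1 (g l)); apply: eq_card.
by rewrite -card_bool; apply: eq_card.
Qed.

(** By [card_agree], every assignment of bits to the distinct positions [p j] extends to the same
    number of strings. *)
Lemma avg_restrict (R : realType) (n : nat) (J : finType) (p : J -> 'I_n)
    (F : {ffun J -> bool} -> R) : injective p ->
  avg (fun x : cube n => F [ffun j => x (p j)]) = avg F.
Proof.
move=> p_inj.
have cardE (z : {ffun J -> bool}) :
    (#|[set x : cube n | [ffun j => x (p j)] == z]| * 2 ^ #|J| = 2 ^ n)%N.
  rewrite -(card_agree (p @: finset.setT)
    [ffun l => [exists j, (p j == l) && z j]]).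
  rewrite card_imset // cardsT; congr (_ * _)%N; apply: eq_card => x.
  rewrite !inE; apply/eqP/forall_inP => [<- _ /imsetP[j _ ->]|agree].
    rewrite ffunE; apply/eqP.
    apply/idP/existsP => [xj|[j' /andP[/eqP/p_inj -> ]]].
      by exists j; rewrite eqxx ffunE.
    by rewrite ffunE.
  apply/ffunP => j; rewrite ffunE.
  have /eqP -> := agree (p j) (imset_f p (finset.in_setT j)).
  rewrite ffunE; apply/existsP/idP => [[j' /andP[/eqP/p_inj -> ]]//|zj].
  by exists j; rewrite eqxx.
have two0 k : 2 ^+ k != 0 :> R by rewrite expf_neq0 // pnatr_eq0.
rewrite /avg card_ffun card_bool card_ord [in RHS]card_ffun card_bool.
rewrite (partition_big (fun x : cube n => [ffun j => x (p j)]) xpredT) //=.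
rewrite mulr_suml [RHS]mulr_suml; apply: eq_bigr => z _.
rewrite (eq_bigr (fun=> F z)) => [|x /eqP -> //].
rewrite sumr_const -[F z *+ _]mulr_natr -mulrA; congr (_ * _).
apply: (mulIf (two0 n)); rewrite natrX divfK // -[X in _ = _ * X]natrX.
rewrite -(cardE z) natrM !natrX mulrCA mulVf ?mulr1 ?two0 //.
by rewrite cardsE.
Qed.

Section PatternTensor.
Variables (R : realType) (m n : nat) (S J : finType).
Variable pos : 'I_m -> {ffun J -> S} -> 'I_n.
Hypothesis pos_inj : forall j j' c c', pos j c = pos j' c' -> j = j' /\ c = c'.
Implicit Types (x : cube n) (s : {ffun J -> {ffun 'I_m -> S}}).

Definition cell s (j : 'I_m) : {ffun J -> S} := [ffun i => s i j].

Definition pattern x s : cube m := [ffun j => x (pos j (cell s j))].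

Lemma avg_pattern (F : cube m -> R) s : avg (fun x => F (pattern x s)) = avg F.
Proof.
by apply: (avg_restrict (p := fun j => pos j (cell s j))) => j j' /pos_inj[].
Qed.

Definition collisions s0 s1 : {set 'I_m} :=
  [set j | [exists i, s0 i j == s1 i j]].

(** In a block without collision the two copies differ in every coordinate, so the mixed cell
    reveals which copy each coordinate came from. *)
Lemma cell_mix_inj s0 s1 j (v v' : {set J}) : j \notin collisions s0 s1 ->
  cell (mix s0 s1 v) j = cell (mix s0 s1 v') j -> v = v'.
Proof.
rewrite inE negb_exists => /forallP jT /ffunP vv'; apply/setP => i.
have := vv' i; rewrite !ffunE; have /eqP := jT i.
by case: ifP; case: ifP => // _ _ ne eq; case: ne.
Qed.

(* If [A] contains a block without collision, flipping the bit of [x] that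
   [s0] selects there negates [chi A] and changes no other pattern. *)
Lemma prod_pattern_vanish (d : nat) (psi : cube m -> R) s0 s1 :
  (forall A : {set 'I_m}, (#|A| < d)%N -> fourier psi A = 0) ->
  (#|collisions s0 s1| < d)%N ->
  avg (fun x => \prod_v psi (pattern x (mix s0 s1 v))) = 0.
Proof.
move=> psi0 Td; rewrite /avg.
(* Only the factor of the empty set, that is of [s0] itself, is expanded into characters; [H] keeps
   the others. *)
pose H x := \prod_(v | v != finset.set0) psi (pattern x (mix s0 s1 v)).
rewrite (eq_bigr (fun x => \sum_A fourier psi A *
    (chi R A (pattern x (mix s0 s1 finset.set0)) * H x))) => [|x _]; last first.
  rewrite (bigD1 finset.set0) //= {1}fourier_expansion mulr_suml.
  by apply: eq_bigr => A _; rewrite -mulrA.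
rewrite exchange_big big1 ?mul0r //= => A _; rewrite -mulr_sumr.
have [/psi0 ->|dA] := ltnP #|A| d; first by rewrite mul0r.
have /fintype.subsetPn[j jA jT] : ~~ (A \subset collisions s0 s1).
  by apply: contraL (leq_trans Td dA) => /subset_leq_card; rewrite -leqNgt.
pose l := pos j (cell (mix s0 s1 finset.set0) j).
pose flip x : cube n := [ffun l' => if l' == l then ~~ x l' else x l'].
have flipK : involutive flip.
  move=> x; apply/ffunP => l'; rewrite !ffunE.
  by case: eqP => // _; rewrite negbK.
have chi_flip x : chi R A (pattern (flip x) (mix s0 s1 finset.set0)) =
    - chi R A (pattern x (mix s0 s1 finset.set0)).
  rewrite /chi !(bigD1 j jA) /= !exprD -mulNr; congr (_ * _).
    by rewrite !ffunE eqxx; case: (x _); rewrite ?opprK.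
  congr (_ ^+ _); apply: eq_bigr => j' /andP[_ jj']; rewrite !ffunE.
  by case: eqP => // /pos_inj[] /eqP; rewrite (negPf jj').
have H_flip x : H (flip x) = H x.
  apply: eq_bigr => v v0; congr psi; apply/ffunP => j'; rewrite !ffunE.
  case: eqP => // /pos_inj[-> /(cell_mix_inj jT) vE].
  by rewrite vE eqxx in v0.
suff /eqP : \sum_x chi R A (pattern x (mix s0 s1 finset.set0)) * H x =
    - \sum_x chi R A (pattern x (mix s0 s1 finset.set0)) * H x.
  by rewrite -addr_eq0 -mulr2n -mulr_natr mulf_eq0 pnatr_eq0 orbF => /eqP ->;
     rewrite mulr0.
rewrite {1}(reindex_inj (inv_inj flipK)) -sumrN.
by apply: eq_bigr => x _; rewrite chi_flip H_flip mulNr.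
Qed.

(* The patterns determine the bits of [x] at the [#|E|] distinct positions
   [loc @: E]: all those selected in blocks without collision, and one in each
   of the other blocks. *)
Lemma prod_pattern_le (psi : cube m -> R) s0 s1 : \sum_z `|psi z| <= 1 ->
  avg (fun x => \prod_v `|psi (pattern x (mix s0 s1 v))|) * 2 ^+ (m * 2 ^ #|J|)
  <= 2 ^+ ((2 ^ #|J|).-1 * #|collisions s0 s1|).
Proof.
move=> psi1; set T := collisions s0 s1.
pose loc (jv : 'I_m * {set J}) := pos jv.1 (cell (mix s0 s1 jv.2) jv.1).
pose E := [set jv : 'I_m * {set J} | (jv.1 \notin T) || (jv.2 == finset.set0)].
have cardE : (#|E| + (2 ^ #|J|).-1 * #|T| = m * 2 ^ #|J|)%N.
  have -> : #|E| = (\sum_j \sum_(v : {set J})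
      ((j \notin T) || (v == finset.set0)))%N.
    rewrite pair_big /= -sum1_card big_mkcond; apply: eq_bigr => jv _.
    by rewrite inE; case: (_ || _).
  have -> : ((2 ^ #|J|).-1 * #|T| =
      \sum_j if j \in T then (2 ^ #|J|).-1 else 0)%N.
    by rewrite -big_mkcond sum_nat_const mulnC.
  rewrite -big_split /=.
  rewrite (eq_bigr (fun=> (2 ^ #|J|)%N)) => [|j _].
    by rewrite sum_nat_const card_ord.
  case: (j \in T) => /=.
    rewrite (bigD1 finset.set0) //= eqxx big1 => [|v /negPf -> //].
    by rewrite addn0 add1n prednK // expn_gt0.
  by rewrite sum_nat_const muln1 addn0 -cardsT -powersetT card_powerset cardsT.
have loc_inj : {in E &, injective loc}.
  have memE j v : ((j, v) \in E) = (j \notin T) || (v == finset.set0).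
    by rewrite inE.
  move=> [j v] [j' v']; rewrite !memE => jvE jvE' /pos_inj[/= jj'].
  subst j'; case: (boolP (j \in T)) jvE jvE' => /= jT.
    by move=> /eqP -> /eqP ->.
  by move=> _ _ /(cell_mix_inj jT) ->.
have two0 k : 2 ^+ k != 0 :> R by rewrite expf_neq0 // pnatr_eq0.
have two_ge0 k : 0 <= 2 ^+ k :> R by rewrite exprn_ge0 ?ler0n.
rewrite -cardE exprD mulrA ler_piMl //.
rewrite /avg card_ffun card_bool card_ord natrX.
rewrite mulrAC ler_pdivrMr ?exprn_gt0 ?ltr0n // mul1r.
(* Strings [x] are grouped by their tuple of patterns. Members of a class agree on [loc @: E], so a
   class has at most 2^(n - #|E|) elements; the products of [psi] over all tuples then sum to a
   power of the l1-norm. *)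
pose Z x := [ffun v : {set J} => pattern x (mix s0 s1 v)].
rewrite (partition_big Z xpredT) //= mulr_suml.
apply: le_trans (_ : \sum_(z : {ffun {set J} -> cube m})
    2 ^+ n * \prod_v `|psi (z v)| <= _).
  apply: ler_sum => z _.
  rewrite (_ : \sum_(x | Z x == z) _ =
      \sum_(x | Z x == z) \prod_v `|psi (z v)|);
    last by apply: eq_bigr => x /eqP <-; apply: eq_bigr => v _; rewrite ffunE.
  rewrite sumr_const -[X in X * _ <= _]mulr_natl mulrAC ler_wpM2r ?prodr_ge0 //.
  have [x0 /eqP Zx0|z0] := pickP (fun x => Z x == z); last first.
    by rewrite eq_card0 ?mul0r // => x; exact: z0.
  rewrite -!natrX -natrM ler_nat -(card_agree (loc @: E) x0) card_in_imset //.
  rewrite leq_mul2r; apply/orP; right; apply: subset_leq_card.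
  apply/fintype.subsetP => x; rewrite inE => xZ.
  have {xZ}Zx : Z x = z by exact/eqP.
  apply/forall_inP => _ /imsetP[[j v] _ ->].
  have /ffunP/(_ v) := etrans Zx (esym Zx0); rewrite !ffunE => /ffunP/(_ j).
  by rewrite !ffunE => ->.
rewrite -mulr_sumr -(bigA_distr_bigA (fun _ : {set J} => fun z => `|psi z|)) /=.
rewrite ler_piMr // Num.Theory.prodr_ile1 // => v _.
by rewrite psi1 sumr_ge0.
Qed.

(** A colliding block contributes one factor [c], at most the product of a [c] for each coinciding
    choice in it. That product splits over independent choices, each of average (#|S| - 1 + c) /
    #|S|. *)
Lemma avg_collisions (c : R) s0 : 1 <= c -> (0 < #|S|)%N ->
  avg (fun s1 => c ^+ #|collisions s0 s1|) <=
  (1 + c / #|S|%:R) ^+ (#|J| * m).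
Proof.
move=> c1 S0; have SR : 0 < #|S|%:R :> R by rewrite ltr0n.
pose h (a b : S) : R := if a == b then c else 1.
have h1 a b : 1 <= h a b by rewrite /h; case: eqP.
apply: le_trans (_ : avg (fun s1 => \prod_i \prod_j h (s0 i j) (s1 i j)) <= _).
  apply: ler_avg => s1.
  rewrite exchange_big -prodr_const big_mkcond /=; apply: ler_prod => j _.
  have prod_ge1 (P : pred J) : 1 <= \prod_(i | P i) h (s0 i j) (s1 i j).
    by elim/big_rec: _ => // i y _ y1; rewrite -[1]mulr1 ler_pM.
  rewrite inE; case: existsP => [[i /eqP si]|_]; last by rewrite ler01 prod_ge1.
  rewrite (le_trans ler01 c1) (bigD1 i) //= {1}/h si eqxx.
  by rewrite ler_peMr ?prod_ge1 // (le_trans ler01).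
rewrite /avg -(bigA_distr_bigA (fun i (t : {ffun 'I_m -> S}) =>
  \prod_j h (s0 i j) (t j))) /=.
rewrite (eq_bigr (fun=> (#|S|%:R + c - 1) ^+ m)) => [|i _]; last first.
  rewrite -(bigA_distr_bigA (fun j b => h (s0 i j) b)) /=.
  rewrite -[X in _ ^+ X]card_ord -prodr_const; apply: eq_bigr => j _.
  rewrite (bigD1 (s0 i j)) //= {1}/h eqxx (eq_bigr (fun=> 1)) => [|b].
    have -> : #|S|%:R = #|S|.-1%:R + 1 :> R by rewrite natr1 prednK.
    by rewrite sumr_const cardC1; ring.
  by rewrite eq_sym /h => /negPf ->.
rewrite prodr_const -exprM mulnC !card_ffun card_ord -expnM mulnC natrX -exprVn.
rewrite -exprMn lerXn2r // ?nnegrE.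
- rewrite mulr_ge0 ?invr_ge0 ?ler0n //; have := ltW SR; lra.
- by rewrite addr_ge0 // divr_ge0 ?ler0n // (le_trans ler01).
rewrite ler_pdivrMr // mulrDl mul1r divfK ?lt0r_neq0 //; lra.
Qed.

End PatternTensor.

(** * Realizing patterns by inputs of the players *)

Section Embedding.
Variables (m n l : nat) (J : finType) (j0 : J).
Local Notation B := {ffun J -> 'I_l}.
Hypothesis room : (m * #|{: B}| <= n)%N.

Lemma position_subproof (j : 'I_m) (c : B) :
  (j * #|{: B}| + enum_rank c < n)%N.
Proof.
apply: leq_trans room; apply: (@leq_trans (j.+1 * #|{: B}|)).
  by rewrite mulSn addnC ltn_add2r ltn_ord.
by rewrite leq_mul2r ltn_ord orbT.
Qed.

Definition position (j : 'I_m) (c : B) : 'I_n :=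
  Ordinal (position_subproof j c).

Lemma position_inj j j' c c' :
  position j c = position j' c' -> j = j' /\ c = c'.
Proof.
move=> [eq_pos].
have B0 : (0 < #|{: B}|)%N by apply: leq_ltn_trans (ltn_ord (enum_rank c)).
have jj' : j = j'.
  apply: val_inj; have := congr1 (fun p => p %/ #|{: B}|)%N eq_pos.
  by rewrite !divnMDl // !divn_small ?ltn_ord // !addn0.
split=> //; move: eq_pos; rewrite jj' => /addnI /val_inj; exact: enum_rank_inj.
Qed.

(* The strings of all players meet in exactly one position per block. *)
Definition selector (i : J) (t : {ffun 'I_m -> 'I_l}) : cube n :=
  [ffun p => [exists j, [exists c, (p == position j c) && (c i == t j)]]].

(** Both sides read [x] along an increasing list of positions, because blocks are laid out in order.
    Two such lists with the same members are equal, and both sides pad with the same default bit. *)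
Lemma select_selector (x : cube n) (s : {ffun J -> {ffun 'I_m -> 'I_l}}) :
  select x (fun i => selector i (s i)) = zero_pad n (pattern position x s).
Proof.
apply/ffunP => p; rewrite !ffunE; congr (nth _ _ _).
pose q j := position j (cell s j).
rewrite [RHS](eq_map (g := x \o q)); last by move=> j; rewrite ffunE.
rewrite map_comp; congr (map _ _).
pose r (a b : 'I_n) := (a < b)%N.
have r_trans : transitive r by move=> b a c; exact: ltn_trans.
have enum_sorted k : sorted (fun a b : 'I_k => (a < b)%N) (enum 'I_k).
  by have := iota_ltn_sorted 0 k; rewrite -val_enum_ord sorted_map.
apply: (irr_sorted_eq r_trans) => [a|||a]; first exact: ltnn.
- exact: sorted_filter (enum_sorted n).
- rewrite sorted_map; apply: sub_sorted (enum_sorted m) => j j' jj'.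
  rewrite /= /r /=; apply: (@leq_trans (j.+1 * #|{: B}|)).
    by rewrite mulSn addnC ltn_add2r ltn_ord.
  by rewrite (leq_trans _ (leq_addr _ _)) // leq_mul2r jj' orbT.
rewrite mem_filter mem_enum andbT; apply/forallP/mapP => [sel|[j _ ->] i].
  (* The selector of player [j0] already excludes the positions beyond the last block. *)
  have [j [c0 aj]] : exists j c, a = position j c.
    have := sel j0; rewrite ffunE => /existsP[j /existsP[c /andP[/eqP aj _]]].
    by exists j, c.
  exists j; first by rewrite mem_enum.
  rewrite aj; congr position; apply/ffunP => i.
  have := sel i; rewrite ffunE => /existsP[j' /existsP[c /andP[/eqP]]].
  by rewrite aj => /position_inj[-> ->] /eqP ->; rewrite ffunE.
rewrite ffunE; apply/existsP; exists j; apply/existsP; exists (cell s j).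
by rewrite eqxx ffunE /=.
Qed.

End Embedding.

(** * Correlation of a pattern function with cylinder intersections *)

Lemma cylinder_pattern_bound (R : realType) (m n d : nat) (S J : finType)
    (pos : 'I_m -> {ffun J -> S} -> 'I_n) (psi : cube m -> R)
    (phi0 : {ffun J -> {ffun 'I_m -> S}} -> R)
    (phi : J -> cube n -> {ffun J -> {ffun 'I_m -> S}} -> R) :
  (forall j j' c c', pos j c = pos j' c' -> j = j' /\ c = c') ->
  (0 < #|S|)%N ->
  2 ^+ (2 ^ #|J|) * expR 1 * (#|J| * m)%:R <= d%:R * #|S|%:R :> R ->
  \sum_z `|psi z| <= 1 ->
  (forall A : {set 'I_m}, (#|A| < d)%N -> fourier psi A = 0) ->
  (forall s, `|phi0 s| <= 1) -> (forall j x s, `|phi j x s| <= 1) ->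
  (forall j x s a, phi j x (update s j a) = phi j x s) ->
  (2 ^+ m * `|avg (fun x => avg (fun s =>
     psi (pattern pos x s) * (phi0 s * \prod_j phi j x s)))|)
    ^+ (2 ^ #|J|) <= 2 ^- d.
Proof.
move=> pos_inj S0 large psi1 psi0 phi0_le phi_le phi_update.
have F0 : (0 < #|{ffun 'I_m -> S}|)%N by rewrite card_ffun expn_gt0 S0.
have V0 : (0 < #|{ffun J -> {ffun 'I_m -> S}}|)%N.
  by rewrite card_ffun expn_gt0 F0.
have two_gt0 k : 0 < 2 ^+ k :> R by rewrite exprn_gt0.
set e := expR 1 : R in large *.
have e_ge1 : 1 <= e by rewrite -(expR0 R) ler_expR ler01.
have e_gt0 : 0 < e by rewrite expR_gt0.
(* The base of the exponential moment. Since 2^(2^#|J| - 1) = c / (2e), a number q >= d of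
   collisions costs c^q (2e)^-q, at most (2e)^-d c^q. *)
pose c : R := 2 ^+ (2 ^ #|J|) * e.
have c_ge1 : 1 <= c by rewrite -[1]mulr1 ler_pM // exprn_ege1 // ler1n.
have c_ge0 : 0 <= c by exact: le_trans ler01 c_ge1.
have e2_gt0 : 0 < 2 * e by rewrite mulr_gt0.
have cE : 2 ^+ (2 ^ #|J|).-1 * (2 * e) = c.
  by rewrite mulrA -exprSr prednK // expn_gt0.
have pointwise s0 s1 :
    2 ^+ (m * 2 ^ #|J|) *
      `|avg (fun x => \prod_v psi (pattern pos x (mix s0 s1 v)))| <=
    (2 * e) ^- d * c ^+ #|collisions s0 s1|.
  have [Td|dT] := ltnP #|collisions s0 s1| d.
    rewrite (prod_pattern_vanish pos_inj psi0) // normr0 mulr0.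
    by rewrite mulr_ge0 ?invr_ge0 ?exprn_ge0 ?c_ge0 // ltW.
  apply: le_trans (_ : 2 ^+ ((2 ^ #|J|).-1 * #|collisions s0 s1|) <= _).
    apply: le_trans (prod_pattern_le pos_inj s0 s1 psi1).
    rewrite [leRHS]mulrC ler_wpM2l ?(ltW (two_gt0 _)) //.
    apply: le_trans (ler_norm_avg _) _; apply: ler_avg => x.
    by rewrite normr_prod.
  rewrite -cE [X in _ * X]exprMn exprM [leRHS]mulrCA.
  rewrite ler_peMr ?exprn_ge0 ?(ltW (two_gt0 _)) //.
  rewrite mulrC ler_pdivlMr ?exprn_gt0 // mul1r.
  by rewrite ler_weXn2l //; lra.
rewrite exprMn -exprM.
apply: le_trans (ler_wpM2l (ltW (two_gt0 _))
  (cylinder_correlation (fun x s => psi (pattern pos x s)) F0 phi0_le phi_le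
    phi_update)) _.
rewrite -avgZ.
apply: (@le_trans _ _ ((2 * e) ^- d * (1 + c / #|S|%:R) ^+ (#|J| * m))).
  rewrite -[leRHS](avg_cst _ V0); apply: ler_avg => s0.
  apply: le_trans (ler_wpM2l _ (avg_collisions s0 c_ge1 S0)); last first.
    by rewrite invr_ge0 exprn_ge0 // mulr_ge0 // ltW.
  by rewrite -!avgZ; apply: ler_avg => s1; exact: pointwise.
rewrite exprMn invfM -mulrA ler_piMr ?invr_ge0 ?(ltW (two_gt0 _)) //.
rewrite ler_pdivrMl ?exprn_gt0 // mulr1.
(* By 1 + t <= e^t and [large], the moment is at most e^d, which cancels the e^-d in (2e)^-d. *)
apply: (@le_trans _ _ (expR (c / #|S|%:R) ^+ (#|J| * m))).
  rewrite lerXn2r ?nnegrE ?expR_ge0 ?expR_ge1Dx //.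
  by rewrite addr_ge0 // divr_ge0 ?ler0n // c_ge0.
rewrite -!expRM_natl ler_expR mulr1 mulrA ler_pdivrMr ?ltr0n //.
by rewrite mulrC.
Qed.

(** * Protocols *)

Section Protocols.
Variables (R : realType) (X Y S J : finType).
Variable u : X -> {ffun J -> S} -> {ffun option J -> Y}.
Hypothesis u_None : forall x x' s,
  visible None (u x s) = visible None (u x' s).
Hypothesis u_Some : forall j x s a,
  visible (Some j) (u x (update s j a)) = visible (Some j) (u x s).

(** Indicators of cylinder intersections are the case of factors with values 0 and 1; Cauchy-Schwarz
    only asks for factors bounded by 1. [phi0] belongs to player 1, who does not see [x]. *)
Definition cylinder_intersection (chi : X -> {ffun J -> S} -> R) : Prop :=
  exists phi0 (phi : J -> X -> {ffun J -> S} -> R),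
    [/\ forall s, `|phi0 s| <= 1, forall j x s, `|phi j x s| <= 1,
      forall j x s a, phi j x (update s j a) = phi j x s &
      forall x s, chi x s = phi0 s * \prod_j phi j x s].

Lemma cylinder_intersection1 : cylinder_intersection (fun _ _ => 1).
Proof.
exists (fun=> 1), (fun _ _ _ => 1).
by split=> *; rewrite ?normr1 // big1 ?mulr1.
Qed.

(** The bit depends only on what its speaker sees, so it can be absorbed into the factor of that
    speaker. *)
Lemma cylinder_intersection_speak chi (i : option J)
    (msg : {ffun {j : option J | j != i} -> Y} -> bool) :
  cylinder_intersection chi ->
  cylinder_intersection (fun x s => chi x s * (msg (visible i (u x s)))%:R).
Proof.
have bool_le (b : bool) : `|b%:R| <= 1 :> R by case: b; rewrite ?normr1 ?normr0.
move=> [phi0 [phi [phi0_le phi_le phi_update chiE]]].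
case: i msg => [i|] msg.
  exists phi0, (fun j x s => phi j x s *
    (if j == i then (msg (visible (Some i) (u x s)))%:R else 1)); split=> //.
  - by move=> j x s; rewrite normrM mulr_ile1 //; case: ifP; rewrite ?normr1.
  - by move=> j x s a; rewrite phi_update; case: eqP => // ->; rewrite u_Some.
  - by move=> x s; rewrite chiE big_split /= -big_mkcond big_pred1_eq mulrA.
(* Player 1 does not see [x], so the bit may be computed at an arbitrary [x0]. *)
have [x0|X0] := pickP X.
  exists (fun s => phi0 s * (msg (visible None (u x0 s)))%:R), phi; split=> //.
    by move=> s; rewrite normrM mulr_ile1.
  by move=> x s; rewrite chiE (u_None x x0) mulrAC.
by exists phi0, phi; split=> // x; have := X0 x.
Qed.

(* The cost is only bounded on the support of [chi]: the tree may be deeper on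
   branches that no input reaches. *)
Lemma protocol_correlation (w : X -> {ffun J -> S} -> R) (D : R) :
  (forall chi, cylinder_intersection chi ->
     `|avg (fun x => avg (fun s => w x s * chi x s))| <= D) ->
  forall (p : protocol (option J) Y bool) (c : nat) chi,
  cylinder_intersection chi ->
  (forall x s, chi x s != 0 -> (bits_written p (u x s) <= c)%N) ->
  `|avg (fun x => avg (fun s => w x s * (chi x s * pm1 R (output p (u x s)))))|
    <= 2 ^+ c * D.
Proof.
move=> wD; have D0 : 0 <= D.
  exact: le_trans (normr_ge0 _) (wD _ cylinder_intersection1).
have avg2D (f g : X -> {ffun J -> S} -> R) :
    avg (fun x => avg (fun s => f x s + g x s)) =
    avg (fun x => avg (f x)) + avg (fun x => avg (g x)).
  rewrite /avg -mulrDl -big_split /=; congr (_ / _); apply: eq_bigr => x _.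
  by rewrite -mulrDl -big_split.
elim=> [b|i msg p0 IH0 p1 IH1] c chi chi_cyl bits /=.
  rewrite (eq_avg (g := fun x => pm1 R b * avg (fun s => w x s * chi x s))).
    rewrite avgZ normrM normr_sign mul1r; apply: le_trans (wD _ chi_cyl) _.
    by rewrite ler_peMl // exprn_ege1 // ler1n.
  by move=> x; rewrite -avgZ; apply: eq_avg => s; ring.
(* A speaking node costs at least one bit, so for [c = 0] the function [chi] vanishes. Otherwise the
   bit splits [chi] in two, with one bit less left for each subtree. *)
case: c bits => [|c] bits.
  rewrite /avg big1 ?mul0r ?normr0 ?mulr_ge0 // => x _.
  rewrite big1 ?mul0r // => s _; have [->|/bits //] := eqVneq (chi x s) 0.
  by rewrite mul0r mulr0.
pose chi1 x s := chi x s * (msg (visible i (u x s)))%:R.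
pose chi0 x s := chi x s * (~~ msg (visible i (u x s)))%:R.
rewrite (eq_avg (g := fun x => avg (fun s =>
    w x s * (chi0 x s * pm1 R (output p0 (u x s))) +
    w x s * (chi1 x s * pm1 R (output p1 (u x s)))))) => [|x]; last first.
  apply: eq_avg => s; rewrite /chi0 /chi1; case: (msg _) => /=; ring.
rewrite avg2D exprS (_ : 2 * _ * D = 2 ^+ c * D + 2 ^+ c * D); last by ring.
apply: le_trans (ler_normD _ _) _; apply: lerD.
- apply: IH0 => [|x s].
    exact: (cylinder_intersection_speak (fun v => ~~ msg v)).
  rewrite mulf_eq0 negb_or => /andP[/bits /=].
  by case: (msg _); rewrite ?eqxx.
- apply: IH1 => [|x s]; first exact: cylinder_intersection_speak.
  rewrite mulf_eq0 negb_or => /andP[/bits /=].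
  by case: (msg _); rewrite ?eqxx.
Qed.

End Protocols.

(** * Averaging over the public coins *)

Lemma sum_probability_le (R : realType) (disp : measure_display)
    (W : measurableType disp) (P : probability W R) (I : finType)
    (A : I -> set W) (c : I -> R) (B : R) :
  (forall i, measurable (A i)) ->
  (forall w, \sum_i c i * \1_(A i) w <= B) ->
  \sum_i c i * fine (P (A i)) <= B.
Proof.
move=> mA cB.
have int i : P.-integrable setT (fun w => (c i)%:E * (\1_(A i) w)%:E)%E.
  by apply: integrableZl => //; exact: integrable_indic.
have : (\int[P]_w (\sum_i (c i)%:E * (\1_(A i) w)%:E) <=
    \int[P]_w (cst B%:E w))%E.
  apply: le_integral => //.
  - exact: integrable_sum.
  - exact: finite_measure_integrable_cst.
  - move=> w _; under eq_bigr do rewrite -EFinM.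
    by rewrite sumEFin lee_fin.
rewrite integral_cst // [X in (_ <= _ * X)%E](_ : _ = 1%E); last first.
  exact: probability_setT.
rewrite mule1 integral_sum //.
rewrite (eq_bigr (fun i => (c i * fine (P (A i)))%:E)) => [|i _].
  by rewrite sumEFin lee_fin.
rewrite integralZl //; last exact: integrable_indic.
by rewrite integral_indic // setIT EFinM fineK // fin_num_measure.
Qed.

(** A correct answer counts 1 and a wrong one -1, with mean 2 P(A i) - 1 between 2 eps and 1.
    Replacing this mean by 1 changes the weighted sum by at most 1 - 2 eps, as the weights have
    l1-norm at most 1. *)
Lemma expected_advantage (R : realType) (disp : measure_display)
    (W : measurableType disp) (P : probability W R) (I : finType)
    (A : I -> set W) (c : I -> R) (eps B : R) :
  (forall i, measurable (A i)) ->
  (forall i, ((1 / 2 + eps)%:E <= P (A i))%E) ->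
  eps <= 1 / 2 -> \sum_i `|c i| <= 1 ->
  (forall w, \sum_i c i * (2 * \1_(A i) w - 1) <= B) ->
  \sum_i c i - (1 - 2 * eps) <= B.
Proof.
move=> mA PA eps1 c1 cB.
have : \sum_i (2 * c i) * fine (P (A i)) <= B + \sum_i c i.
  apply: sum_probability_le => // w; rewrite -lerBlDr -sumrB.
  by apply: le_trans (cB w); apply: ler_sum => i _; rewrite le_eqVlt; apply/orP;
     left; apply/eqP; ring.
suff : \sum_i (c i * 2 - 2 * c i * fine (P (A i))) <= 1 - 2 * eps.
  by rewrite sumrB -mulr_suml; lra.
apply: le_trans (_ : (1 - 2 * eps) * \sum_i `|c i| <= _); last first.
  by rewrite ler_piMr //; lra.
rewrite mulr_sumr; apply: ler_sum => i _.
have PA1 : fine (P (A i)) <= 1.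
  by rewrite -lee_fin fineK ?fin_num_measure // probability_le1.
have PAe : 1 / 2 + eps <= fine (P (A i)).
  by rewrite -lee_fin fineK ?fin_num_measure.
have := ler_norm (c i); have := normr_ge0 (c i).
nra.
Qed.

Lemma avg_avgE (R : realType) (T U : finType) (F : T -> U -> R) :
  avg (fun t => avg (F t)) = \sum_p F p.1 p.2 / (#|T|%:R * #|U|%:R).
Proof.
rewrite -mulr_suml -(pair_big xpredT xpredT F) /= /avg -mulr_suml -mulrA.
by congr (_ * _); rewrite invfM mulrC.
Qed.

Lemma advantage_le_cost (R : realType) (m n d l c : nat) (J : finType) (j0 : J)
    (eps delta D : R) (f : cube m -> bool) (f' : cube n -> bool)
    (room : (m * #|{: {ffun J -> 'I_l}}| <= n)%N) :
  (0 < d)%N -> (0 < l)%N -> eps <= 1 / 2 ->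
  2 ^+ (2 ^ #|J|) * expR 1 * (#|J| * m)%:R <= d%:R * l%:R :> R ->
  is_approx_degree delta (fun z => pm1 R (f z)) d ->
  (forall z, f z = f' (zero_pad n z)) ->
  0 <= D -> D ^+ (2 ^ #|J|) = 2 ^- d ->
  randomized_cost_le eps (fun u : {ffun option J -> cube n} =>
    f' (select (u None) (fun i => u (Some i)))) c ->
  delta + 2 * eps - 1 <= 2 ^+ c * D.
Proof.
move=> d0 l0 eps1 large fdeg ff' D0 DE [disp [W [P [pi [bits correct]]]]].
have [psi [psi1 psif psi0]] := dual_polynomial d0 fdeg.
pose pos := position room.
have pos_inj : forall j j' c c', pos j c = pos j' c' -> j = j' /\ c = c'.
  exact: position_inj.
pose V := {ffun J -> {ffun 'I_m -> 'I_l}}.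
pose u (x : cube n) (s : V) : {ffun option J -> cube n} :=
  [ffun o => if o is Some i then selector room i (s i) else x].
have S0 : (0 < #|'I_l|)%N by rewrite card_ord.
have V0 : (0 < #|{: V}|)%N by rewrite !card_ffun !expn_gt0 S0.
have X0 : (0 < #|{: cube n}|)%N by rewrite card_ffun expn_gt0 card_bool.
have u_None x x' s : visible None (u x s) = visible None (u x' s).
  by apply/ffunP => -[[i|] //= oi]; rewrite !ffunE.
have u_Some j x s a :
    visible (Some j) (u x (update s j a)) = visible (Some j) (u x s).
  apply/ffunP => -[[i|] /= oi]; rewrite !ffunE //.
  by congr (selector _ _ _); rewrite /update ffunE ifN.
pose g (t : {ffun option J -> cube n}) :=
  f' (select (t None) (fun i => t (Some i))).
have gu x s : g (u x s) = f (pattern pos x s).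
  rewrite ff' -(select_selector j0) /g ffunE; congr (f' (select _ _)).
  by apply: boolp.funext => i; rewrite ffunE.
(* Under this normalization a function of the pattern, summed over all inputs, gives its plain sum
   over the cube. The weights [C] thus inherit the l1-norm of [psi] and its correlation with [f]. *)
pose scale : R := 2 ^+ m / (#|{: cube n}|%:R * #|{: V}|%:R).
have scaleE (F : cube n -> V -> R) :
    \sum_(p : cube n * V) scale * F p.1 p.2 = 2 ^+ m * avg (fun x => avg (F x)).
  rewrite avg_avgE mulr_sumr; apply: eq_bigr => p _.
  by rewrite /scale -!mulrA; congr (_ * _); rewrite mulrC.
have marginal (F : cube m -> R) :
    2 ^+ m * avg (fun x => avg (fun s : V => F (pattern pos x s))) = \sum_z F z.
  rewrite exchange_avg (eq_avg (avg_pattern pos_inj F)) (avg_cst _ V0) /avg.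
  rewrite card_ffun card_bool card_ord natrX mulrC divfK //.
have scale0 : 0 <= scale by rewrite divr_ge0 ?mulr_ge0 ?exprn_ge0 ?ler0n.
pose C (p : cube n * V) : R :=
  scale * (psi (pattern pos p.1 p.2) * pm1 R (f (pattern pos p.1 p.2))).
pose A (p : cube n * V) : set W :=
  [set w | output (pi w) (u p.1 p.2) = g (u p.1 p.2)]%classic.
apply: le_trans (_ : \sum_p C p - (1 - 2 * eps) <= _).
  rewrite (scaleE (fun x s =>
    psi (pattern pos x s) * pm1 R (f (pattern pos x s)))).
  by rewrite (marginal (fun z => psi z * pm1 R (f z))); lra.
apply: (@expected_advantage _ _ _ P _ A) => //.
- by move=> p; have [] := correct (u p.1 p.2).
- by move=> p; have [] := correct (u p.1 p.2).
- apply: le_trans psi1; rewrite -marginal -scaleE; apply: ler_sum => p _.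
  by rewrite /C normrM (ger0_norm scale0) normrM normr_sign mulr1.
move=> w.
(* As signs, 2 1_A - 1 is the product of the output and [f], so the sign of [f] in [C] cancels. The
   factor 1 is the trivial cylinder intersection. *)
rewrite (eq_bigr (fun p => scale * (psi (pattern pos p.1 p.2) *
    (1 * pm1 R (output (pi w) (u p.1 p.2)))))) => [|p _]; last first.
  rewrite /C -!mulrA mul1r; do 2 congr (_ * _); rewrite indicE /A -gu.
  case: (boolP (w \in _)); rewrite ?inE ?notin_setE /=.
    by move=> ->; rewrite mulr1 (_ : 2 - 1 = 1) ?mulr1 //; ring.
  rewrite mulr0 add0r /pm1.
  by case: (output _ _) (g _) => -[] //= _; rewrite ?expr0 ?expr1; ring.
rewrite (scaleE (fun x s => psi (pattern pos x s) *
  (1 * pm1 R (output (pi w) (u x s))))).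
apply: le_trans (ler_norm _) _; rewrite normrM ger0_norm ?exprn_ge0 //.
have two0 : 0 < 2 ^+ m :> R by rewrite exprn_gt0.
rewrite -ler_pdivlMl // mulrCA.
apply: (protocol_correlation u_None u_Some) => // [chi|]; last first.
  exact: cylinder_intersection1.
move=> [phi0 [phi [phi0_le phi_le phi_update chiE]]].
rewrite ler_pdivlMl // -(ler_pXn2r (n := 2 ^ #|J|)) ?expn_gt0 ?nnegrE //.
rewrite DE.
rewrite (eq_avg (g := fun x => avg (fun s : V => psi (pattern pos x s) *
    (phi0 s * \prod_j phi j x s)))).
  by apply: cylinder_pattern_bound; rewrite ?card_ord.
by move=> x; apply: eq_avg => s; rewrite chiE.
Qed.

(** * Choice of the block side and conclusion *)

Unset Implicit Arguments.

Theorem mainTheorem3 (R : realType) (k m n d : nat) (eps delta : R)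
    (f : cube m -> bool) (f' : cube n -> bool)
    (hk : (2 <= k)%N) (heps0 : 0 < eps) (heps1 : eps <= 1 / 2)
    (* d > 0 and delta + 2 eps - 1 > 0: the quotient by d and the logarithm
       are defined *)
    (hd : (0 < d)%N) (hlog : 0 < delta + 2 * eps - 1)
    (hf : is_approx_degree delta (fun z => pm1 R (f z)) d)
    (hn : (2 ^+ (2 ^ k)%N * k.-1%:R * expR 1 / d%:R) ^+ k.-1 * m%:R ^+ k
          <= n%:R :> R)
    (hf' : forall z : cube m, f z = f' (zero_pad n z)) :
  ((d%:R / 2 ^+ k.-1 + log2 (delta + 2 * eps - 1))%:E
     <= randomized_complexity eps (@G k n f'))%E.
Proof.
case: k hk hn => [|[|K]] //= _ hn.
have dm := approx_degree_le hf.
have dR : 0 < d%:R :> R by rewrite ltr0n.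
set e := expR 1 : R in hn.
have e_ge1 : 1 <= e by rewrite -(expR0 R) ler_expR ler01.
(* [L] is the real side for which [hn] reads m L^(k-1) <= n, and [l] rounds it down. As [d <= m]
   gives [L >= 2], rounding loses at most a factor 2, which the surplus 2^(2^(k-1)) in [Q]
   absorbs. *)
pose Q : R := 2 ^+ (2 ^ K.+2) * K.+1%:R * e / d%:R.
pose L := Q * m%:R.
pose l := Num.truncn L.
have K1 : 1 <= K.+1%:R :> R by rewrite ler1n.
have two_ge1 j : 1 <= 2 ^+ j :> R by rewrite exprn_ege1 // ler1n.
have LE : d%:R * L = 2 ^+ (2 ^ K.+1) * 2 ^+ (2 ^ K.+1) * (e * (K.+1 * m)%:R).
  rewrite -exprD addnn -mul2n -expnS /L /Q natrM; field; exact: lt0r_neq0.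
have two_le : 2 <= 2 ^+ (2 ^ K.+1) :> R.
  by rewrite -[leLHS]expr1 ler_weXn2l ?ler1n // expn_gt0.
have L2 : 2 <= L.
  rewrite -(ler_pM2l dR) LE -[leLHS]mulrC -mulrA ler_pM ?ler0n //.
  apply: (@le_trans _ _ (1 * (1 * m%:R))); first by rewrite !mul1r ler_nat.
  apply: ler_pM; rewrite ?mul1r ?ler0n ?ler01 //.
  by rewrite -[leLHS]mul1r ler_pM ?ler0n ?ler01 // ler_nat leq_pmull.
have /andP[lL Ll] : l%:R <= L < l.+1%:R.
  by apply: truncn_itv; apply: le_trans L2.
have l2 : L <= 2 * l%:R by rewrite -natr1 in Ll; lra.
have l0 : (0 < l)%N by rewrite -(ltr0n R); lra.
have room : (m * #|{: {ffun 'I_K.+1 -> 'I_l}}| <= n)%N.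
  rewrite card_ffun !card_ord -(ler_nat R) natrM natrX.
  apply: le_trans hn; rewrite -/Q [leRHS](_ : _ = m%:R * L ^+ K.+1).
    by rewrite ler_wpM2l ?ler0n // lerXn2r // nnegrE ?ler0n //; lra.
  by rewrite -/Q /L [in RHS]exprMn [m%:R ^+ K.+2]exprS mulrCA.
have large : 2 ^+ (2 ^ #|'I_K.+1|) * expR 1 * (#|'I_K.+1| * m)%:R
    <= d%:R * l%:R :> R.
  rewrite card_ord -/e -mulrA.
  have Y0 : 0 <= 2 ^+ (2 ^ K.+1) * (e * (K.+1 * m)%:R).
    by rewrite !mulr_ge0 ?exprn_ge0 ?ler0n ?expR_ge0.
  have := ler_wpM2r Y0 two_le.
  rewrite [in X in X -> _](mulrA (2 ^+ _) (2 ^+ _)) -LE.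
  have := ler_wpM2l (ltW dR) l2; lra.
have ln2 : 0 < ln 2 :> R by rewrite ln_gt0 // ltr1n.
(* The 2^(k-1)-th root of 2^-d; its logarithm yields the term d / 2^(k-1). *)
pose D := expR (- (d%:R * ln 2 / 2 ^+ K.+1)) : R.
have DE : D ^+ (2 ^ #|'I_K.+1|) = 2 ^- d.
  rewrite card_ord -expRM_natl natrX mulrN mulrC divfK; last first.
    by rewrite expf_neq0 // pnatr_eq0.
  by rewrite expRN expRM_natl lnK // posrE.
apply: le_ereal_inf_tmp => _ [c hc <-]; rewrite lee_fin.
have := @advantage_le_cost R m n d l c 'I_K.+1 ord0 eps delta D f f' room
  hd l0 heps1 large hf hf' (expR_ge0 _) DE hc.
rewrite -ler_ln ?posrE ?mulr_gt0 ?exprn_gt0 ?expR_gt0 //.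
rewrite lnM ?posrE ?exprn_gt0 ?expR_gt0 // lnXn // expRK => le_ln.
rewrite /log2 -(ler_pM2r ln2) mulrDl divfK ?lt0r_neq0 //.
rewrite mulrAC addrC -lerBrDr.
by rewrite -[_ *+ c]mulr_natl in le_ln.
Qed.
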